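(* Let $(G,T,\ell,u,w)$ be a PESP instance with $n=|V(G)|$ and space of feasible periodic timetables $\Pi$. Then $\Pi/\mathbb{R}\mathbf{1}\subset\mathbb{R}^{V(G)}/\mathbb{R}\mathbf{1}\cong\mathbb{R}^n/\mathbb{R}\mathbf{1}$ is the union of the sets $R(p)/\mathbb{R}\mathbf{1}$, $p\in\mathbb{Z}^{A(G)}$; these sets are pairwise disjoint (for distinct $p$), and each of them is a polytrope.
   Context: A PESP instance $(G,T,\ell,u,w)$ consists of a finite directed graph $G$ with vertex set $V(G)$ and arc set $A(G)$, a positive integer $T$, and vectors $\ell,u,w\in\mathbb{R}^{A(G)}$. Standing assumptions: $G$ is simple, 2-connected (as an undirected graph), has no pair of antiparallel arcs, and $0\le \ell_a<T$, $0\le u_a-\ell_a<T$ for all arcs $a$. $\Pi=\{\pi\in\mathbb{R}^{V(G)} \mid \exists p\in\mathbb{Z}^{A(G)}\ \forall (i,j)\in A(G):\ \ell_{ij}\le \pi_j-\pi_i+Tp_{ij}\le u_{ij}\}$. For $p\in\mathbb{Z}^{A(G)}$, $R(p)=\{\pi\in\mathbb{R}^{V(G)} \mid \forall (i,j)\in A(G):\ \ell_{ij}-Tp_{ij}\le \pi_j-\pi_i\le u_{ij}-Tp_{ij}\}$. Both $\Pi$ and $R(p)$ are invariant under translation by $\mathbb{R}\mathbf{1}$, where $\mathbf{1}=(1,\dots,1)$; $\Pi/\mathbb{R}\mathbf{1}$ and $R(p)/\mathbb{R}\mathbf{1}$ denote their images in $\mathbb{R}^{V(G)}/\mathbb{R}\mathbf{1}$.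 Tropical operations: $a\oplus b=\min\{a,b\}$, $a\odot b=a+b$. The tropical convex hull of a finite set of points of $\mathbb{R}^n/\mathbb{R}\mathbf{1}$ with representatives $v_1,\dots,v_k\in\mathbb{R}^n$ is the image in $\mathbb{R}^n/\mathbb{R}\mathbf{1}$ of $\{(a_1\odot v_1)\oplus\dots\oplus(a_k\odot v_k)\mid a_1,\dots,a_k\in\mathbb{R}\}$ (scalar multiplication and sum coordinatewise). A polytrope is the tropical convex hull of a finite (possibly empty) set of points in $\mathbb{R}^n/\mathbb{R}\mathbf{1}$ that is also convex in the ordinary sense. *)

(* Defs.v *)
From HB Require Import structures.
From mathcomp Require Import all_boot all_order all_algebra.
From mathcomp Require Import boolp classical_sets reals constructive_ereal convex.

Set Implicit Arguments.
Unset Strict Implicit.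
Unset Printing Implicit Defensive.

Import Order.TTheory GRing.Theory Num.Theory.

Local Open Scope classical_set_scope.
Local Open Scope ring_scope.
Local Open Scope quotient_scope.

Section TropicalTorus.
Variables (R : realType) (I : finType).

Definition ones_line : {pred {ffun I -> R^o}} :=
  fun x => `[< exists a : R, x = [ffun=> a] >].

Fact ones_line_zmod_closed : zmod_closed ones_line.
Proof.
split; first by apply/asboolP; exists 0; apply/ffunP => i; rewrite !ffunE.
move=> x y /asboolP[a ->] /asboolP[b ->].
by apply/asboolP; exists (a - b); apply/ffunP => i; rewrite !ffunE.
Qed.

HB.instance Definition _ :=
  GRing.isZmodClosed.Build {ffun I -> R^o} ones_line ones_line_zmod_closed.

Definition torus : Type := Quotient.quot ones_line.

HB.instance Definition _ := GRing.Zmodule.on torus.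
HB.instance Definition _ := EqQuotient.on torus.

Definition to_torus (x : {ffun I -> R^o}) : torus := \pi_torus x.

Definition torus_scale (a : R) (q : torus) : torus := to_torus (a *: repr q).

Lemma eq_to_torus (x y : {ffun I -> R^o}) :
  to_torus x = to_torus y <-> exists a : R, x - y = [ffun=> a].
Proof.
have E : (x - y \in ones_line) = (to_torus x == to_torus y).
  exact: (Quotient.idealrBE ones_line x y).
split=> [/eqP|xy]; first by rewrite -E => /asboolP.
by apply/eqP; rewrite -E; apply/asboolP.
Qed.

Lemma to_torusK (q : torus) : to_torus (repr q) = q.
Proof. exact: reprK. Qed.

Lemma to_torusD : {morph to_torus : x y / x + y}.
Proof. exact: (@Quotient.pi_add _ ones_line). Qed.

Lemma to_torus_scale (a : R) (x : {ffun I -> R^o}) :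
  torus_scale a (to_torus x) = to_torus (a *: x).
Proof.
apply/eq_to_torus; have /eq_to_torus[b xb] := to_torusK (to_torus x).
by exists (a * b); rewrite -scalerBr xb; apply/ffunP => i; rewrite !ffunE.
Qed.

Fact torus_scaleA (a b : R) (q : torus) :
  torus_scale a (torus_scale b q) = torus_scale (a * b) q.
Proof. by rewrite -(to_torusK q) !to_torus_scale scalerA. Qed.

Fact torus_scale1 : left_id 1 torus_scale.
Proof. by move=> q; rewrite -(to_torusK q) to_torus_scale scale1r. Qed.

Fact torus_scaleDr : right_distributive torus_scale +%R.
Proof.
move=> a q r; rewrite -(to_torusK q) -(to_torusK r) -to_torusD.
by rewrite !to_torus_scale -to_torusD scalerDr.
Qed.

Fact torus_scaleDl (q : torus) : {morph torus_scale^~ q : a b / a + b}.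
Proof.
by move=> a b; rewrite -(to_torusK q) !to_torus_scale -to_torusD scalerDl.
Qed.

HB.instance Definition _ := GRing.Zmodule_isLmodule.Build R torus
  torus_scaleA torus_scale1 torus_scaleDr torus_scaleDl.

Definition mod_ones (A : set {ffun I -> R^o}) : set torus := to_torus @` A.

(* The tropical sum is formed in the extended reals because its neutral
   element is +oo; hence for k = 0 no real vector qualifies (I inhabited). *)
Definition tropical_hull (k : nat) (v : 'I_k -> {ffun I -> R^o}) : set torus :=
  mod_ones [set x | exists a : 'I_k -> R, forall i : I,
    (x i)%:E = \big[Order.min/+oo%E]_(j < k) (a j + v j i)%:E].

Definition polytrope (P : set torus) : Prop :=
  (exists (k : nat) (v : 'I_k -> {ffun I -> R^o}), P = tropical_hull v)
  /\ convex_set P.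

End TropicalTorus.

(* Encoding arcs as a relation already excludes parallel arcs. *)
Record digraph := Digraph { vertex :> finType; adj : rel vertex }.

Definition arc_of (G : digraph) : finType := {ij : G * G | adj ij.1 ij.2}.
Definition source (G : digraph) (a : arc_of G) : G := (val a).1.
Definition target (G : digraph) (a : arc_of G) : G := (val a).2.

Definition undirected_connected_without (G : digraph) (X : {set G}) : Prop :=
  forall x y : G, x \notin X -> y \notin X ->
    connect [rel a b | [&& a \notin X, b \notin X & adj a b || adj b a]] x y.

Definition two_connected (G : digraph) : Prop :=
  (2 < #|G|)%N /\
  forall X : {set G}, (#|X| < 2)%N -> undirected_connected_without X.

Record pesp (R : realType) := Pesp {
  graph : digraph;
  period : nat;
  lower : {ffun arc_of graph -> R};
  upper : {ffun arc_of graph -> R};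
  weight : {ffun arc_of graph -> R};
  pesp_loopless : irreflexive (@adj graph);
  pesp_no_antiparallel : forall i j : graph, adj i j -> ~~ adj j i;
  pesp_two_connected : two_connected graph;
  period_gt0 : (0 < period)%N;
  lower_range : forall a : arc_of graph, 0 <= lower a < period%:R;
  span_range : forall a : arc_of graph, 0 <= upper a - lower a < period%:R
}.

Section Timetables.
Variables (R : realType) (N : pesp R).

Definition tension (x : {ffun graph N -> R^o}) (a : arc_of (graph N)) : R :=
  x (target a) - x (source a).

Definition feasible_timetables : set {ffun graph N -> R^o} :=
  [set x | exists p : {ffun arc_of (graph N) -> int},
     forall a : arc_of (graph N),
     lower N a <= tension x a + (period N)%:R * (p a)%:~R <= upper N a].

Definition region (p : {ffun arc_of (graph N) -> int}) :
    set {ffun graph N -> R^o} :=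
  [set x | forall a : arc_of (graph N),
     lower N a - (period N)%:R * (p a)%:~R <= tension x a
       <= upper N a - (period N)%:R * (p a)%:~R].

End Timetables.

Arguments feasible_timetables {R} N _.
Arguments region {R} N p _.

(* Main.v *)
Require Import Defs.
From mathcomp Require Import all_boot all_order all_algebra.
From mathcomp Require Import boolp classical_sets reals.
From mathcomp Require Import constructive_ereal interval_inference convex lra.

Import Order.TTheory GRing.Theory Num.Theory.

Local Open Scope classical_set_scope.

(** A region is cut out by inequalities [x_t - x_s <= c], which are stable under
    translation along the ones vector, under convex combinations and under
    tropical combinations.  Put [d(i,j) = sup {x_j - x_i}] over a nonempty
    region; this is finite because the graph is connected.  Then every
    [v_i = d(i,-)] satisfies the inequalities, and every point [x] of the region
    is the tropical combination [x_j = min_i (x_i + d(i,j))].  Disjointness holds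
    because two distinct periodic offsets of an arc move its interval of
    admissible tensions by at least the period, which exceeds its length. *)

Section DifferencePolyhedra.
Context {R : realType} {I : finType} {K : Type}.
Variables (s t : K -> I) (c : K -> R).

Local Open Scope ring_scope.

Definition difference_polyhedron : set {ffun I -> R^o} :=
  [set x | forall k, (x (t k) : R) - x (s k) <= c k].

Local Notation D := difference_polyhedron.

(** A finite supremum only when [D] is nonempty and these differences are bounded above; elsewhere
    [sup] is a default value. *)
Definition max_difference (i j : I) : R := sup [set (x j : R) - x i | x in D].

Lemma difference_polyhedron_translate (x y : {ffun I -> R^o}) :
  to_torus x = to_torus y -> D y -> D x.
Proof.
move=> /eq_to_torus[a /ffunP xy] Dy k.
have := Dy k; have := xy (t k); have := xy (s k); rewrite !ffunE => /= ? ? ?.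
lra.
Qed.

Lemma convex_difference_polyhedron : convex_set (mod_ones D).
Proof.
move=> _ _ l /set_mem[x Dx <-] /set_mem[y Dy <-]; apply/mem_set.
exists (l%:num *: x + (1 - l%:num) *: y).
  move=> k; rewrite !ffunE /=.
  have l0 : 0 <= l%:num by [].
  have l1 : 0 <= 1 - l%:num by rewrite subr_ge0.
  have := ler_wpM2l l0 (Dx k); have := ler_wpM2l l1 (Dy k).
  rewrite /GRing.scale /=; lra.
by rewrite to_torusD -!to_torus_scale.
Qed.

Lemma tropical_hull_sub_difference_polyhedron (k : nat)
    (v : 'I_k -> {ffun I -> R^o}) :
  (forall j, D (v j)) -> tropical_hull v `<=` mod_ones D.
Proof.
move=> Dv _ [x [a xa] <-]; exists x => // m.
(* In this form the minimum [x (s m)] is bounded below, which can be checked term by term. *)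
suff: ((x (t m) - c m)%:E <= (x (s m))%:E)%E by rewrite lee_fin; lra.
rewrite [leRHS]xa; apply/bigmin_geP; split=> [|j _]; first exact: leey.
have : ((x (t m))%:E <= (a j + v j (t m))%:E)%E by rewrite xa; exact: bigmin_le.
by rewrite !lee_fin; have := Dv j m; lra.
Qed.

Hypothesis D_bounded : forall i j, exists M : R, forall x, D x ->
  (x j : R) - x i <= M.

Lemma ge_max_difference (x : {ffun I -> R^o}) (i j : I) :
  D x -> (x j : R) - x i <= max_difference i j.
Proof.
move=> Dx; apply: ub_le_sup; last by exists x.
by have [M DM] := D_bounded i j; exists M => _ [y Dy <-]; exact: DM.
Qed.

(** Triangle inequality: each [x] in [D] has [x_t - x_i <= (x_s - x_i) + c <= d(i,s) + c]; take the
    supremum over [x] on the left. *)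
Lemma max_difference_in (i : I) :
  D !=set0 -> D [ffun j => max_difference i j].
Proof.
move=> [x0 Dx0] k; rewrite !ffunE lerBlDl.
apply: ge_sup => [|_ [x Dx <-]]; first by exists (x0 (t k) - x0 i), x0.
by have := Dx k; have := ge_max_difference x i (s k) Dx; lra.
Qed.

Lemma max_difference_diag (i : I) : D !=set0 -> max_difference i i = 0.
Proof.
move=> [x Dx]; apply/eqP; rewrite eq_le; apply/andP; split.
  by apply: ge_sup => [|_ [y _ <-]]; [exists (x i - x i), x | rewrite subrr].
by have := ge_max_difference x i i Dx; rewrite subrr.
Qed.

Lemma polytrope_difference_polyhedron (i0 : I) : polytrope (mod_ones D).
Proof.
split; last exact: convex_difference_polyhedron.
have [D0|/nonemptyPn D0] := pselect (D !=set0); last first.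
  exists 0%N, (fun=> 0); rewrite D0 /mod_ones image_set0.
  apply/esym/seteqP; split=> // q [x [a xa] _].
  (* The empty minimum is [+oo], while the coordinate at [i0] is real. *)
  by have := xa i0; rewrite big_ord0.
exists #|I|, (fun j => [ffun i => max_difference (enum_val j) i]).
apply/seteqP; split; last first.
  by apply: tropical_hull_sub_difference_polyhedron => j; exact: max_difference_in.
move=> _ [x Dx <-]; exists x => //; exists (fun j => x (enum_val j)) => i.
apply/eqP; rewrite eq_le; apply/andP; split.
  apply/bigmin_geP; split=> [|j _]; first exact: leey.
  by rewrite lee_fin ffunE; have := ge_max_difference x (enum_val j) i Dx; lra.
(* The minimum is attained at the index [i] itself, since [d(i,i) = 0]. *)
apply: (bigmin_inf (enum_rank i)) => //.
by rewrite ffunE enum_rankK max_difference_diag // addr0.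
Qed.

End DifferencePolyhedra.

Section Regions.
Context {R : realType} (N : pesp R).
Implicit Types p q : {ffun arc_of (graph N) -> int}.

Local Open Scope ring_scope.
Local Notation T := ((period N)%:R : R).

(** Each arc gives two constraints: [inl] for its upper bound, [inr] for its lower bound with the
    endpoints swapped. *)
Lemma region_difference_polyhedron p :
  region N p = difference_polyhedron
    (fun k : arc_of (graph N) + arc_of (graph N) =>
       match k with inl a => source a | inr a => target a end)
    (fun k => match k with inl a => target a | inr a => source a end)
    (fun k => match k with
              | inl a => upper N a - T * (p a)%:~R
              | inr a => T * (p a)%:~R - lower N a
              end).
Proof.
apply/seteqP; split=> x Dx.
  by case=> a; have := Dx a; rewrite /tension => /andP[] /=; lra.
move=> a; have := Dx (inl a); have := Dx (inr a); rewrite /tension /= => ? ?.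
apply/andP; split; lra.
Qed.

Lemma region_bounded p (i j : graph N) :
  exists M : R, forall x, region N p x -> (x j : R) - x i <= M.
Proof.
(* Deleting no vertex in 2-connectedness gives an undirected path; the bounds of its steps add
   up. *)
have /connectP[r + ->] : connect [rel a b | [&& a \notin finset.set0,
    b \notin finset.set0 & adj a b || adj b a]] i j.
  by apply: (pesp_two_connected N).2; rewrite ?cards0 ?finset.in_set0.
elim: r i => [|k r IHr] i /=; first by exists 0 => x _; rewrite subrr.
move=> /andP[/and3P[_ _ ik] /IHr[M HM]].
have [M' HM'] : exists M' : R, forall x, region N p x -> (x k : R) - x i <= M'.
  case/orP: ik => ik.
  - pose a : arc_of (graph N) := Sub (i, k) ik.
    by exists (upper N a - T * (p a)%:~R) => x /(_ a)/andP[].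
  - pose a : arc_of (graph N) := Sub (k, i) ik.
    exists (- (lower N a - T * (p a)%:~R)) => x /(_ a)/andP[+ _].
    by rewrite /tension /source /target /=; lra.
by exists (M + M') => x Dx; have := HM x Dx; have := HM' x Dx; lra.
Qed.

Lemma polytrope_region p : polytrope (mod_ones (region N p)).
Proof.
have /card_gt0P[i0 _] : (0 < #|graph N|)%N.
  by apply: leq_trans (pesp_two_connected N).1.
have := region_bounded p; rewrite region_difference_polyhedron => Db.
exact: polytrope_difference_polyhedron Db i0.
Qed.

Lemma region_inj p q (x : {ffun graph N -> R^o}) :
  region N p x -> region N q x -> p = q.
Proof.
move=> px qx; apply/ffunP => a.
have T0 : 0 < T by rewrite ltr0n period_gt0.
have /andP[? ?] := px a; have /andP[? ?] := qx a.
have /andP[_ ?] := span_range a.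
(* Both shifted tensions lie between [lower] and [upper], at distance less than [T]. Hence the
   integer [p a - q a] has absolute value below 1. *)
have : `|T * (p a - q a)%:~R| < T * 1.
  by rewrite mulr1 intrB mulrBr ltr_norml; apply/andP; split; lra.
rewrite normrM (gtr0_norm T0) (ltr_pM2l T0) -intr_norm (ltr_int R _ 1).
by rewrite (ltzD1 _ 0) normr_le0 subr_eq0 => /eqP.
Qed.

Lemma feasible_timetables_bigcup : feasible_timetables N = \bigcup_p region N p.
Proof.
apply/seteqP; split=> [x [p xp]|x [p _ xp]].
- by exists p => // a; have /andP[? ?] := xp a; apply/andP; split; lra.
- by exists p => a; have /andP[? ?] := xp a; apply/andP; split; lra.
Qed.

End Regions.

Theorem theorem3p6 (R : realType) (N : pesp R) :
  [/\ mod_ones (feasible_timetables N) = \bigcup_p mod_ones (region N p),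
      trivIset setT (fun p => mod_ones (region N p))
    & forall p : {ffun arc_of (graph N) -> int}, polytrope (mod_ones (region N p))].
Proof.
split; last exact: polytrope_region.
- by rewrite feasible_timetables_bigcup /mod_ones image_bigcup.
(* A common class has representatives [x] and [y] differing by a translation, so [x] lies in both
   regions. *)
- move=> p q _ _ [_ [[x px <-] [y qy yx]]]; apply: (@region_inj _ _ _ _ x px).
  move: qy; rewrite region_difference_polyhedron.
  exact: difference_polyhedron_translate (esym yx).
Qed.
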